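(* Let $\textsc{Alg}$ be any deterministic fixed-phase algorithm for the file migration problem, and consider the dynamic graph model (in which between phases the adversary may arbitrarily replace the metric space while keeping the distance between the files of $\textsc{Opt}$ and $\textsc{Alg}$ unchanged). Then the competitive ratio of $\textsc{Alg}$ is at least $R_0$ for $D$ tending to infinity, where $R_0\approx 4.086$ is the largest real root of $R^3-5R^2+3R+3=0$ (this $R_0$ is the competitive ratio of the algorithm Move-To-Local-Min of Bartal et al.).
   Context: File migration problem: a metric space $(\mathcal{X},d)$ and a file size $D$ are given; a single indivisible file is stored at a point of $\mathcal{X}$. Requests $r_1,r_2,\ldots\in\mathcal{X}$ arrive online; in step $t$ the algorithm pays $d(\textsc{alg}_{t-1},r_t)$ to serve $r_t$, then may move the file to any point $\textsc{alg}_t$ paying $D\cdot d(\textsc{alg}_{t-1},\textsc{alg}_t)$. An algorithm is $c$-competitive if there is a constant $\gamma$ with $C_{\mathrm{ALG}}(\mathcal{I})\le c\cdot C_{\mathrm{OPT}}(\mathcal{I})+\gamma$ for all inputs $\mathcal{I}$, where $C_{\mathrm{OPT}}$ is the optimal offline cost; the competitive ratio is the infimum of such $c$. A fixed-phase algorithm chooses a phase length $c\cdot D$ (fixed constant $c>0$) and after every $c\cdot D$ requests makes a migration decision based solely on its current position and the last $c\cdot D$ requests (it keeps its file in place during a phase and stores no history beyond the current phase). Dynamic graph model: let $f$ be the distance between the files of $\textsc{Alg}$ and $\textsc{Opt}$ at the end of a phase; at the start of the next phase the adversary may discard the current metric space and create a new one, choosing a new position for $\textsc{Alg}$'s file, then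 presents the phase's requests, runs $\textsc{Alg}$, and finally chooses $\textsc{Opt}$'s strategy for that phase subject only to the initial distance between the files of $\textsc{Opt}$ and $\textsc{Alg}$ being exactly $f$. ''For $D$ tending to infinity'' means that for every $\varepsilon>0$ the lower bound $R_0-\varepsilon$ holds once $D$ is sufficiently large. *)

(* Defs.v *)
From Stdlib Require Import Reals List.
From Coquelicot Require Import Coquelicot.
Import ListNotations.
Open Scope R_scope.

(* The decision rule sees the file size, the current metric space, the position
   of the file and the requests of the current phase, and returns the new
   position of the file.  [c * D] need not be an integer, so the number of
   requests in a phase is an arbitrary rounding of it. *)
Record fixed_phase_algorithm : Type := {
  phase_const : R;
  phase_const_pos : 0 < phase_const;
  phase_length : R -> nat;
  phase_length_spec :
    forall D : R, 0 < D -> Rabs (INR (phase_length D) - phase_const * D) < 1;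
  decide : forall (D : R) (X : Metric_Space), Base X -> list (Base X) -> Base X
}.

(* [opt_moves] lists the positions of Opt's file after each request. *)
Record phase : Type := {
  space : Metric_Space;
  alg_start : Base space;
  requests : list (Base space);
  opt_start : Base space;
  opt_moves : list (Base space)
}.

Definition alg_end (Alg : fixed_phase_algorithm) (D : R) (p : phase) :
    Base (space p) :=
  decide Alg D (space p) (alg_start p) (requests p).

Definition opt_end (p : phase) : Base (space p) :=
  last (opt_moves p) (opt_start p).

Fixpoint service_cost (X : Metric_Space) (x : Base X) (rs : list (Base X)) : R :=
  match rs with
  | [] => 0
  | r :: rs' => dist X x r + service_cost X x rs'
  end.

Definition alg_phase_cost (Alg : fixed_phase_algorithm) (D : R) (p : phase) : R :=
  service_cost (space p) (alg_start p) (requests p)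
  + D * dist (space p) (alg_start p) (alg_end Alg D p).

Fixpoint trajectory_cost (D : R) (X : Metric_Space) (x : Base X)
    (rs ys : list (Base X)) : R :=
  match rs, ys with
  | r :: rs', y :: ys' =>
      dist X x r + D * dist X x y + trajectory_cost D X y rs' ys'
  | _, _ => 0
  end.

Definition opt_phase_cost (D : R) (p : phase) : R :=
  trajectory_cost D (space p) (opt_start p) (requests p) (opt_moves p).

(* [f] is the distance between the files of Alg and Opt before the first phase
   of the list; it is the only information carried from one phase to the next. *)
Fixpoint legal_play (Alg : fixed_phase_algorithm) (D f : R) (ps : list phase) :
    Prop :=
  match ps with
  | [] => True
  | p :: ps' =>
      length (requests p) = phase_length Alg D /\
      length (opt_moves p) = length (requests p) /\
      dist (space p) (opt_start p) (alg_start p) = f /\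
      legal_play Alg D (dist (space p) (opt_end p) (alg_end Alg D p)) ps'
  end.

Fixpoint alg_cost (Alg : fixed_phase_algorithm) (D : R) (ps : list phase) : R :=
  match ps with
  | [] => 0
  | p :: ps' => alg_phase_cost Alg D p + alg_cost Alg D ps'
  end.

Fixpoint opt_cost (D : R) (ps : list phase) : R :=
  match ps with
  | [] => 0
  | p :: ps' => opt_phase_cost D p + opt_cost D ps'
  end.

(* Both files start at the same point.  Quantifying over all plays, hence over
   all strategies of Opt, amounts to comparing with the optimal one. *)
Definition competitive (Alg : fixed_phase_algorithm) (D rho : R) : Prop :=
  exists gamma : R, forall ps : list phase,
    legal_play Alg D 0 ps -> alg_cost Alg D ps <= rho * opt_cost D ps + gamma.

(* Equals [p_infty] when no real ratio is achieved. *)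
Definition competitive_ratio (Alg : fixed_phase_algorithm) (D : R) : Rbar :=
  Glb_Rbar (competitive Alg D).

Definition mtlm_poly (x : R) : R := x ^ 3 - 5 * x ^ 2 + 3 * x + 3.

Definition largest_root (P : R -> R) (x : R) : Prop :=
  P x = 0 /\ forall y : R, P y = 0 -> y <= x.

(* Main.v *)
(* Let V(f) be the supremum of C_ALG - R C_OPT over all plays that start with the
   files at distance f, and suppose that V(f) >= psi D f for all f.  A one-phase
   play on a bipartite graph with Alg at distance F > R - 1 from all candidate
   positions of Opt improves psi by a fixed amount as long as psi <= F / (F - 2),
   so psi can be taken close to (R - 1) / (R - 3).  In a two-point space with both
   files at one point, requesting the other point k times gains at least
   s (k - R D + psi D) if Alg stays and s (k + D - R k + psi D) if it moves, where
   s is the distance of the points.  Some k makes both gains positive as soon as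
   psi > R - 1 - 1/R, and s is arbitrary, so no additive constant suffices.  The
   two bounds on psi are compatible exactly when R^3 - 5R^2 + 3R + 3 < 0.  The
   phase length only matters when it is shorter than k; then whole phases of
   requests at the other point are used, for ever if Alg never moves. *)

Require Import Defs.
From Stdlib Require Import Reals List Lra Lia.
From Coquelicot Require Import Coquelicot.
Import ListNotations.
Open Scope R_scope.

(** * Plays and the amount they gain *)

(** Encodes V(f) >= v by one witnessing play, so that V, possibly infinite, is never formed. *)
Definition can_gain (Alg : fixed_phase_algorithm) (D R f v : R) : Prop :=
  exists ps : list phase,
    legal_play Alg D f ps /\ v <= alg_cost Alg D ps - R * opt_cost D ps.

Lemma can_gain_le (Alg : fixed_phase_algorithm) (D R f v w : R) :
  w <= v -> can_gain Alg D R f v -> can_gain Alg D R f w.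
Proof. intros Hwv [ps [Hps Hv]]. exists ps. split; [exact Hps | lra]. Qed.

Lemma can_gain_0 (Alg : fixed_phase_algorithm) (D R f : R) :
  can_gain Alg D R f 0.
Proof. exists []. simpl. split; [exact I | lra]. Qed.

Lemma can_gain_cons (Alg : fixed_phase_algorithm) (D R f v w : R) (p : phase) :
  length (requests p) = phase_length Alg D ->
  length (opt_moves p) = length (requests p) ->
  dist (space p) (opt_start p) (alg_start p) = f ->
  can_gain Alg D R (dist (space p) (opt_end p) (alg_end Alg D p)) w ->
  v <= alg_phase_cost Alg D p - R * opt_phase_cost D p + w ->
  can_gain Alg D R f v.
Proof.
  intros Hrs Hys Hf [ps [Hps Hw]] Hv.
  exists (p :: ps). simpl. split; [tauto | nra].
Qed.

Lemma dist_self (X : Metric_Space) (x : Base X) : dist X x x = 0.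
Proof. now apply (dist_refl X). Qed.

Lemma last_repeat {T : Type} (x : T) (n : nat) : last (repeat x n) x = x.
Proof.
  induction n as [|[|n] IHn]; [reflexivity | reflexivity | exact IHn].
Qed.

Lemma trajectory_cost_stay (D : R) (X : Metric_Space) (x : Base X)
    (rs : list (Base X)) :
  trajectory_cost D X x rs (repeat x (length rs)) = service_cost X x rs.
Proof.
  induction rs as [|r rs IH]; simpl; [reflexivity|].
  rewrite IH, dist_self. ring.
Qed.

Lemma can_gain_opt_stays (Alg : fixed_phase_algorithm) (D R f v w : R)
    (X : Metric_Space) (a o : Base X) (rs : list (Base X)) :
  length rs = phase_length Alg D ->
  dist X o a = f ->
  can_gain Alg D R (dist X o (decide Alg D X a rs)) w ->
  v <= service_cost X a rs + D * dist X a (decide Alg D X a rs)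
       - R * service_cost X o rs + w ->
  can_gain Alg D R f v.
Proof.
  intros Hrs Hf Hw Hv.
  apply (can_gain_cons _ _ _ _ _ w (Build_phase X a rs o (repeat o (length rs))));
    unfold alg_phase_cost, opt_phase_cost, opt_end, alg_end; simpl; trivial.
  - apply repeat_length.
  - now rewrite last_repeat.
  - now rewrite trajectory_cost_stay.
Qed.

Lemma service_cost_const (X : Metric_Space) (x : Base X) (d : R)
    (rs : list (Base X)) :
  (forall r, In r rs -> dist X x r = d) ->
  service_cost X x rs = INR (length rs) * d.
Proof.
  induction rs as [|r rs IH]; intros Hd; [simpl; ring|].
  change (service_cost X x (r :: rs)) with (dist X x r + service_cost X x rs).
  rewrite (Hd r) by now left.
  rewrite IH by (intros; apply Hd; now right).
  change (length (r :: rs)) with (S (length rs)). rewrite S_INR. ring.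
Qed.

Lemma service_cost_app (X : Metric_Space) (x : Base X) (rs rs' : list (Base X)) :
  service_cost X x (rs ++ rs') = service_cost X x rs + service_cost X x rs'.
Proof.
  induction rs as [|r rs IH]; simpl; [ring|]. rewrite IH. ring.
Qed.

Lemma trajectory_cost_nonneg (D : R) (X : Metric_Space) (rs : list (Base X)) :
  0 <= D -> forall x ys, 0 <= trajectory_cost D X x rs ys.
Proof.
  intros HD. induction rs as [|r rs IH]; intros x [|y ys]; simpl; try lra.
  pose proof (dist_pos X x r). pose proof (dist_pos X x y).
  specialize (IH y ys). nra.
Qed.

Lemma opt_cost_nonneg (D : R) (ps : list phase) : 0 <= D -> 0 <= opt_cost D ps.
Proof.
  intros HD. induction ps as [|p ps IH]; simpl; [lra|].
  pose proof (trajectory_cost_nonneg D (space p) (requests p) HD (opt_start p)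
    (opt_moves p)).
  unfold opt_phase_cost. lra.
Qed.

(** * The bipartite play *)

(* Path metric of an infinite complete bipartite graph minus a perfect matching,
   with a hub joined to the left side by edges of length [F]. *)
Inductive bip : Type := hub | left_pt (i : nat) | right_pt (i : nat).

Definition bip_dist (F : R) (x y : bip) : R :=
  match x, y with
  | hub, hub => 0
  | hub, left_pt _ | left_pt _, hub => F
  | hub, right_pt _ | right_pt _, hub => F + 1
  | left_pt i, left_pt j | right_pt i, right_pt j => if Nat.eqb i j then 0 else 2
  | left_pt i, right_pt j | right_pt i, left_pt j => if Nat.eqb i j then 3 else 1
  end.

Ltac case_eqb :=
  repeat match goal with
  | |- context [Nat.eqb ?i ?j] => destruct (Nat.eqb_spec i j)
  end.

(** [HF] keeps detours through the hub, of length 2F or 2F + 1, from undercutting the distances 2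
    and 3. The scale [A] fits the hub edges to any given f. *)
Definition bip_space (F A : R) (HF : 1 <= F) (HA : 0 < A) : Metric_Space.
Proof.
  refine (Build_Metric_Space bip (fun x y => A * bip_dist F x y) _ _ _ _).
  - intros x y. apply Rle_ge, Rmult_le_pos; [lra|].
    destruct x, y; simpl; case_eqb; lra.
  - intros x y. f_equal. destruct x, y; simpl; case_eqb; subst; congruence || lra.
  - intros x y. split.
    + intros H. apply Rmult_integral in H. destruct H as [H|H]; [lra|].
      destruct x, y; simpl in H; revert H; case_eqb; intros; subst;
        reflexivity || lra.
    + intros <-. destruct x; simpl; rewrite ?Nat.eqb_refl; ring.
  - intros x y z. rewrite <- Rmult_plus_distr_l.
    apply Rmult_le_compat_l; [lra|].
    destruct x, y, z; simpl; case_eqb; subst; congruence || lra.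
Defined.

(** The point at distance 3 is requested at most once, hence one excess of 2; the [if] tells whether
    that request can still come. *)
Lemma service_cost_left_pt (F A : R) (HF : 1 <= F) (HA : 0 < A) (i n m : nat) :
  service_cost (bip_space F A HF HA) (left_pt i) (map right_pt (seq m n))
  <= A * (INR n + if Nat.ltb i m then 0 else 2).
Proof.
  revert m. induction n as [|n IH]; intros m.
  - simpl. destruct (Nat.ltb i m); nra.
  - rewrite S_INR. simpl seq. simpl map. simpl service_cost.
    specialize (IH (S m)). revert IH.
    destruct (Nat.ltb_spec i (S m)), (Nat.ltb_spec i m), (Nat.eqb_spec i m);
      intros; lia || nra.
Qed.

(* Alg pays [F + 1] per request, Opt only [1].  If Alg moves to a [left_pt],
   Opt sits at another one, at distance [2]; if Alg moves to a requested
   [right_pt], Opt sits at the only [left_pt] at distance [3] from it. *)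
Lemma bipartite_play (Alg : fixed_phase_algorithm) (D R F psi delta : R) :
  0 < R -> 1 <= F -> R - 1 <= F -> 0 <= psi -> psi * (F - 2) <= F ->
  2 * R <= D ->
  delta * D * F <= INR (phase_length Alg D) * (F + 1 - R) ->
  (forall f, 0 <= f -> can_gain Alg D R f (psi * D * f)) ->
  forall f, 0 <= f -> can_gain Alg D R f ((psi + delta) * D * f).
Proof.
  intros HR HF1 HF Hpsi HpsiF HD Hdelta IH f Hf.
  destruct (Req_dec f 0) as [->|Hf0].
  { rewrite Rmult_0_r. apply can_gain_0. }
  assert (HA : 0 < f / F) by (apply Rdiv_lt_0_compat; lra).
  set (A := f / F) in HA.
  assert (HfA : f = A * F) by (unfold A; field; lra).
  clearbody A. subst f.
  set (N := phase_length Alg D) in *.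
  set (X := bip_space F A HF1 HA).
  set (rs := map right_pt (seq 0 N) : list (Base X)).
  assert (Hlen : length rs = N) by (unfold rs; now rewrite length_map, length_seq).
  assert (Halg : service_cost X hub rs = INR N * (A * (F + 1))).
  { rewrite <- Hlen at 1. apply service_cost_const.
    intros r Hr. apply in_map_iff in Hr. destruct Hr as [j [<- _]]. reflexivity. }
  assert (Hfree : forall j, (N <= j)%nat ->
    service_cost X (left_pt j) rs = INR N * A).
  { intros j Hj. rewrite <- Hlen. apply service_cost_const.
    intros r Hr. apply in_map_iff in Hr. destruct Hr as [i [<- Hi]].
    apply in_seq in Hi. simpl. case_eqb; [lia | ring]. }
  assert (HAD : 0 <= A * D) by nra.
  assert (Hgain : A * (delta * D * F) <= A * (INR N * (F + 1 - R)))
    by (apply Rmult_le_compat_l; lra).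
  (* Alg's migration cost pays for the potential lost when the distance falls from AF to 2A. *)
  assert (Hmove : A * D * (psi * (F - 2)) <= A * D * F)
    by (apply Rmult_le_compat_l; lra).
  assert (step : forall (o : Base X),
    dist X o hub = A * F ->
    (psi + delta) * D * (A * F)
      <= INR N * (A * (F + 1)) + D * dist X hub (decide Alg D X hub rs)
         - R * service_cost X o rs
         + psi * D * dist X o (decide Alg D X hub rs) ->
    can_gain Alg D R (A * F) ((psi + delta) * D * (A * F))).
  { intros o Ho Hv.
    eapply (can_gain_opt_stays _ _ _ _ _ _ X hub o rs Hlen Ho).
    - apply IH. apply Rge_le, (dist_pos X).
    - rewrite Halg. exact Hv. }
  destruct (decide Alg D X hub rs) as [|i|i] eqn:Hz.
  - apply (step (left_pt N)); [reflexivity|].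
    rewrite (Hfree N) by lia. simpl. nra.
  (* This index differs from i and lies beyond all requested ones. *)
  - apply (step (left_pt (S (N + i)))); [reflexivity|].
    rewrite (Hfree (S (N + i))) by lia.
    change (dist X hub (left_pt i)) with (A * F).
    assert (Hd : dist X (left_pt (S (N + i))) (left_pt i) = A * 2)
      by (cbn [dist X bip_space bip_dist]; case_eqb; [lia | reflexivity]).
    rewrite Hd. nra.
  (* Opt's excess of 2A, weighted by R, is covered by the extra A D that Alg pays to reach the right
     side. *)
  - apply (step (left_pt i)); [reflexivity|].
    pose proof (service_cost_left_pt F A HF1 HA i N 0) as Hs.
    change (service_cost X (left_pt i) rs <= A * (INR N + 2)) in Hs.
    apply (Rmult_le_compat_l R) in Hs; [|lra].
    assert (A * (2 * R) <= A * D) by (apply Rmult_le_compat_l; lra).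
    assert (0 <= psi * (A * D)) by (apply Rmult_le_pos; lra).
    change (dist X hub (right_pt i)) with (A * (F + 1)).
    assert (Hd : dist X (left_pt i) (right_pt i) = A * 3)
      by (cbn [dist X bip_space bip_dist]; case_eqb; [reflexivity | lia]).
    rewrite Hd. nra.
Qed.

(** Each round adds the same [delta], positive because F > R - 1, so finitely many rounds lead from
    0 to [psi]. The cap [Rmin] keeps the constraint on the potential valid throughout. *)
Lemma iterated_bipartite_play (Alg : fixed_phase_algorithm) (D R F psi : R) :
  0 < R -> 1 <= F -> R - 1 < F -> 0 <= psi -> psi * (F - 2) <= F ->
  2 * R <= D -> (0 < phase_length Alg D)%nat ->
  forall f, 0 <= f -> can_gain Alg D R f (psi * D * f).
Proof.
  intros HR HF1 HF Hpsi HpsiF HD HN.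
  apply lt_0_INR in HN.
  set (delta := INR (phase_length Alg D) * (F + 1 - R) / (D * F)).
  assert (HDF : 0 < D * F) by nra.
  assert (Hdelta : 0 < delta) by (apply Rdiv_lt_0_compat; nra).
  assert (HdeltaE : delta * D * F = INR (phase_length Alg D) * (F + 1 - R))
    by (unfold delta; field; nra).
  assert (H : forall n f, 0 <= f ->
    can_gain Alg D R f (Rmin psi (INR n * delta) * D * f)).
  { induction n as [|n IH].
    - intros f Hf. simpl. rewrite Rmult_0_l, Rmin_right by lra.
      rewrite !Rmult_0_l. apply can_gain_0.
    - set (psi' := Rmin psi (INR n * delta)) in IH.
      assert (0 <= INR n * delta) by (apply Rmult_le_pos; [apply pos_INR | lra]).
      assert (Hpsi' : 0 <= psi') by (apply Rmin_glb; lra).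
      assert (psi' <= psi) by apply Rmin_l.
      intros f Hf.
      apply (can_gain_le _ _ _ _ ((psi' + delta) * D * f)).
      + assert (Rmin psi (INR (S n) * delta) <= psi' + delta).
        { rewrite S_INR. unfold psi', Rmin.
          destruct (Rle_dec psi (INR n * delta)),
            (Rle_dec psi ((INR n + 1) * delta)); nra. }
        rewrite !Rmult_assoc. apply Rmult_le_compat_r; nra.
      + apply (bipartite_play Alg D R F); try lra; trivial.
        (* For F < 2 the left side is nonpositive; otherwise it is monotone in the potential. *)
        destruct (Rle_dec 2 F); nra. }
  destruct (INR_unbounded (psi / delta)) as [n Hn].
  intros f Hf. specialize (H n f Hf).
  rewrite Rmin_left in H; [exact H|].
  apply Rmult_gt_compat_r with (r := delta) in Hn; [|exact Hdelta].
  replace (psi / delta * delta) with psi in Hn by (field; lra). lra.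
Qed.

(** * The two-point play *)

Definition two_dist (s : R) (x y : bool) : R := if Bool.eqb x y then 0 else s.

Definition two_space (s : R) (Hs : 0 < s) : Metric_Space.
Proof.
  refine (Build_Metric_Space bool (two_dist s) _ _ _ _); unfold two_dist.
  - intros [] []; simpl; lra.
  - intros [] []; reflexivity.
  - intros [] []; simpl; split; intros; congruence || lra.
  - intros [] [] []; simpl; lra.
Defined.

(** Opt moves only after serving, so the first request at [true] costs s on top of the migration D
    s. *)
Lemma trajectory_cost_two_follow (D s : R) (Hs : 0 < s) (j k : nat) :
  trajectory_cost D (two_space s Hs) false
    (repeat false j ++ repeat true (S k)) (repeat false j ++ repeat true (S k))
  = (1 + D) * s.
Proof.
  induction j as [|j IH].
  - simpl. replace (trajectory_cost D (two_space s Hs) true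
      (repeat true k) (repeat true k)) with 0; [unfold two_dist; simpl; ring|].
    induction k as [|k IHk]; simpl; [reflexivity|].
    rewrite <- IHk. unfold two_dist. simpl. ring.
  - change (repeat false (S j)) with (false :: repeat false j).
    rewrite <- !app_comm_cons. cbn [trajectory_cost]. rewrite IH.
    simpl. unfold two_dist. simpl. ring.
Qed.

(** A decision sees only its phase, so an Alg that stays once stays in every repetition, while Opt
    waits at [true] for free. *)
Lemma can_gain_two_stay (Alg : fixed_phase_algorithm) (D R s : R) (Hs : 0 < s) :
  decide Alg D (two_space s Hs) false (repeat true (phase_length Alg D)) = false ->
  forall m, can_gain Alg D R s (INR m * (INR (phase_length Alg D) * s)).
Proof.
  set (N := phase_length Alg D). set (X := two_space s Hs).
  intros Hz m. induction m as [|m IH].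
  - simpl. rewrite Rmult_0_l. apply can_gain_0.
  - eapply (can_gain_opt_stays _ _ _ _ _ _ X false true (repeat true N)).
    + apply repeat_length.
    + reflexivity.
    + rewrite Hz. exact IH.
    + rewrite Hz, !dist_self.
      rewrite (service_cost_const X false s), (service_cost_const X true 0).
      * rewrite repeat_length, S_INR. lra.
      * intros r Hr. apply repeat_spec in Hr. now subst.
      * intros r Hr. apply repeat_spec in Hr. now subst.
Qed.

(** Opt does the opposite of Alg, so the files end at distance s. The leading requests at [false]
    are free padding. *)
Lemma can_gain_two (Alg : fixed_phase_algorithm) (D R s psi : R) (k : nat)
    (Hs : 0 < s) :
  (0 < k <= phase_length Alg D)%nat ->
  let X := two_space s Hs in
  let rs := repeat false (phase_length Alg D - k) ++ repeat true k in
  (decide Alg D X false rs = true ->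
     can_gain Alg D R s (psi * D * s) ->
     can_gain Alg D R 0 (s * (INR k + D - R * INR k + psi * D))) /\
  (decide Alg D X false rs = false ->
     forall w, can_gain Alg D R s w ->
     can_gain Alg D R 0 (s * (INR k - R * (1 + D)) + w)).
Proof.
  intros Hk X rs.
  assert (Hlen : length rs = phase_length Alg D).
  { unfold rs. rewrite length_app, !repeat_length. lia. }
  assert (Hcost : service_cost X false rs = INR k * s).
  { unfold rs. rewrite service_cost_app.
    rewrite (service_cost_const X false 0 (repeat false _)),
      (service_cost_const X false s (repeat true _)).
    - rewrite !repeat_length. ring.
    - intros r Hr. apply repeat_spec in Hr. now subst.
    - intros r Hr. apply repeat_spec in Hr. now subst. }
  split; intros Hz.
  - intros Hw.
    eapply (can_gain_opt_stays _ _ _ _ _ _ X false false rs Hlen).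
    + reflexivity.
    + rewrite Hz. exact Hw.
    + rewrite Hz, Hcost. simpl. unfold two_dist. simpl. lra.
  - intros w Hw.
    apply (can_gain_cons _ _ _ _ _ w (Build_phase X false rs false rs));
      unfold alg_phase_cost, opt_phase_cost, opt_end, alg_end;
      cbn [space requests alg_start opt_start opt_moves]; trivial.
    + rewrite Hz. unfold rs. destruct k as [|k]; [lia|].
      replace (S k) with (k + 1)%nat by lia.
      rewrite repeat_app, app_assoc. simpl repeat. rewrite last_last. exact Hw.
    + rewrite Hz, Hcost, dist_self. unfold rs, X.
      destruct k as [|k]; [lia|]. rewrite trajectory_cost_two_follow. lra.
Qed.

(** The slack 1 in both bounds on [k] becomes the gain s. In a phase shorter than [k], the bound for
    a moving Alg holds a fortiori as R > 1. *)
Lemma two_point_play (Alg : fixed_phase_algorithm) (D R s psi : R) (k : nat) :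
  0 < s -> 1 < R -> (0 < phase_length Alg D)%nat -> (0 < k)%nat ->
  (forall f, 0 <= f -> can_gain Alg D R f (psi * D * f)) ->
  R * (1 + D) - psi * D + 1 <= INR k ->
  (R - 1) * INR k + 1 <= (1 + psi) * D ->
  can_gain Alg D R 0 s.
Proof.
  intros Hs HR HN Hk0 Hpsi Hstay Hmove.
  destruct (Nat.le_gt_cases k (phase_length Alg D)) as [Hk|Hk].
  - destruct (can_gain_two Alg D R s psi k Hs (conj Hk0 Hk)) as [H1 H2].
    destruct (decide Alg D (two_space s Hs) _ _).
    + apply (can_gain_le _ _ _ _ _ s) in H1; trivial; [nra|].
      apply Hpsi; lra.
    + specialize (H2 eq_refl (psi * D * s)).
      apply (can_gain_le _ _ _ _ _ s) in H2; trivial; [nra|].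
      apply Hpsi; lra.
  - set (N := phase_length Alg D) in *.
    destruct (can_gain_two Alg D R s psi N Hs (conj HN (le_n N))) as [H1 H2].
    fold N in H1, H2. rewrite Nat.sub_diag in H1, H2. simpl app in H1, H2.
    apply lt_INR in Hk.
    destruct (decide Alg D (two_space s Hs) _ _) eqn:Hz.
    + apply (can_gain_le _ _ _ _ _ s) in H1; trivial.
      * assert ((R - 1) * INR N <= (R - 1) * INR k)
          by (apply Rmult_le_compat_l; lra).
        nra.
      * apply Hpsi; lra.
    + apply lt_INR in HN. simpl in HN.
      (* Enough idle phases to outweigh the R (1 + D) s charged for Opt's single move. *)
      destruct (INR_unbounded ((1 + R * (1 + D)) / INR N)) as [m Hm].
      apply Rmult_gt_compat_r with (r := INR N) in Hm; [|exact HN].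
      replace ((1 + R * (1 + D)) / INR N * INR N) with (1 + R * (1 + D)) in Hm
        by (field; lra).
      apply (can_gain_le _ _ _ _
        (s * (INR N - R * (1 + D)) + INR m * (INR N * s))); [nra|].
      apply (H2 eq_refl). exact (can_gain_two_stay Alg D R s Hs Hz m).
Qed.

(** * Constants *)

Lemma mtlm_poly_root :
  exists R0 : R, 40855 / 10000 < R0 < 40865 / 10000 /\ mtlm_poly R0 = 0.
Proof.
  destruct (IVT mtlm_poly (40855 / 10000) (40865 / 10000)) as [z [Hz Hz0]].
  - unfold mtlm_poly. apply derivable_continuous. reg.
  - lra.
  - unfold mtlm_poly; lra.
  - unfold mtlm_poly; lra.
  - exists z. split; [|exact Hz0]. unfold mtlm_poly in Hz0.
    split; apply Rnot_le_lt; intros Hle.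
    + replace z with (40855 / 10000) in Hz0 by lra. lra.
    + replace z with (40865 / 10000) in Hz0 by lra. lra.
Qed.

(** Makes the root found above the largest one, and the polynomial negative on [4, R0). *)
Lemma mtlm_poly_increasing (x y : R) :
  4 <= x -> x < y -> mtlm_poly x < mtlm_poly y.
Proof.
  intros Hx Hxy. unfold mtlm_poly.
  assert (0 < x ^ 2 + x * y + y ^ 2 - 5 * (x + y) + 3) by nra.
  assert (0 < (y - x) * (x ^ 2 + x * y + y ^ 2 - 5 * (x + y) + 3))
    by (apply Rmult_lt_0_compat; lra).
  lra.
Qed.

(* At [F = R - 1] the two conditions on [psi] are compatible
   exactly when [mtlm_poly R < 0]. *)
Lemma potential_constants (R : R) :
  4 <= R -> mtlm_poly R < 0 ->
  exists F psi, R - 1 < F /\ psi * (F - 2) <= F /\ R * R - R - 1 < R * psi /\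
    psi <= 3.
Proof.
  intros HR HP. unfold mtlm_poly in HP.
  (* The value that [psi] must exceed in the two-point play. *)
  set (q := R - 1 - / R).
  assert (HRq : R * q = R * R - R - 1) by (unfold q; field; lra).
  assert (Hq : 2 < q) by nra.
  (* Cleared of denominators, this is [mtlm_poly R < 0]. *)
  assert (HF : R - 1 < 2 * q / (q - 1)).
  { apply Rmult_lt_reg_r with (q - 1); [lra|].
    replace (2 * q / (q - 1) * (q - 1)) with (2 * q) by (field; lra).
    apply Rmult_lt_reg_l with R; [lra|]. nra. }
  (* F / (F - 2) decreases and equals [q] at 2q / (q - 1), so the midpoint leaves room on both
     sides. *)
  set (F := (R - 1 + 2 * q / (q - 1)) / 2).
  assert (HF1 : R - 1 < F) by (unfold F; lra).
  assert (HF2 : F * (q - 1) < 2 * q).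
  { replace (2 * q) with (2 * q / (q - 1) * (q - 1)) by (field; lra).
    apply Rmult_lt_compat_r; unfold F; lra. }
  assert (Hpsi : F / (F - 2) * (F - 2) = F) by (field; lra).
  exists F, (F / (F - 2)). repeat split; try lra.
  - rewrite <- HRq. apply Rmult_lt_compat_l; [lra|].
    apply Rmult_lt_reg_r with (F - 2); lra.
  - apply Rmult_le_reg_r with (F - 2); lra.
Qed.

Lemma not_competitive (Alg : fixed_phase_algorithm) (R : R) :
  4 <= R -> mtlm_poly R < 0 ->
  exists D0, 0 < D0 /\ forall D, D0 <= D -> ~ competitive Alg D R.
Proof.
  intros HR HP.
  destruct (potential_constants R HR HP) as [F [psi [HF [HpsiF [Hpsi Hpsi3]]]]].
  set (c := phase_const Alg). pose proof (phase_const_pos Alg) as Hc. fold c in Hc.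
  set (g := R * psi - (R * R - R - 1)).
  assert (Hg : 0 < g) by (unfold g; lra).
  assert (0 < 1 / c) by (apply Rdiv_lt_0_compat; lra).
  assert (0 < (R * R + R + 1) / g) by (apply Rdiv_lt_0_compat; nra).
  (* The summands ensure a nonempty phase, the bound 2R <= D of the bipartite play, and room for an
     integer between the two bounds on [k]. *)
  exists (1 / c + 2 * R + (R * R + R + 1) / g). split; [lra|].
  intros D HD [gamma Hgamma].
  assert (HcD : 1 <= c * D).
  { replace 1 with (c * (1 / c)) by (field; lra). apply Rmult_le_compat_l; lra. }
  assert (HgD : R * R + R + 1 <= g * D).
  { replace (R * R + R + 1) with (g * ((R * R + R + 1) / g)) at 1 by (field; lra).
    apply Rmult_le_compat_l; lra. }
  assert (HN : (0 < phase_length Alg D)%nat).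
  { apply INR_lt. simpl.
    pose proof (phase_length_spec Alg D ltac:(lra)) as HN.
    apply Rabs_def2 in HN. fold c in HN. lra. }
  assert (Hpsi0 : 0 <= psi) by nra.
  pose proof (iterated_bipartite_play Alg D R F psi ltac:(lra) ltac:(lra) HF Hpsi0
    HpsiF ltac:(lra) HN) as Hgain.
  (* The argument is nonnegative because psi <= 3 < R. *)
  destruct (nfloor_ex (R * (1 + D) - psi * D + 1) ltac:(nra)) as [k [Hk1 Hk2]].
  assert (Hs : 0 < Rabs gamma + 1) by (pose proof (Rabs_pos gamma); lra).
  destruct (two_point_play Alg D R _ psi (S k) Hs ltac:(lra) HN ltac:(lia) Hgain)
    as [ps [Hps Hv]].
  - rewrite S_INR. lra.
  - rewrite S_INR. unfold g in HgD. nra.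
  - specialize (Hgamma ps Hps). pose proof (Rle_abs gamma). lra.
Qed.

Theorem theorem2 :
  exists R0 : R,
    largest_root mtlm_poly R0 /\
    Rabs (R0 - 4086 / 1000) < 1 / 2000 /\
    forall (Alg : fixed_phase_algorithm) (eps : R), 0 < eps ->
      exists D0 : R, 0 < D0 /\
        forall D : R, D0 <= D ->
          Rbar_le (Finite (R0 - eps)) (competitive_ratio Alg D).
Proof.
  destruct mtlm_poly_root as [R0 [HR0 Hroot]].
  exists R0. split; [|split].
  - split; [exact Hroot|]. intros y Hy. apply Rnot_lt_le. intros Hlt.
    pose proof (mtlm_poly_increasing R0 y ltac:(lra) Hlt). lra.
  - apply Rabs_def1; lra.
  - intros Alg eps Heps.
    (* For large [eps] the ratio is raised to 4, where the lemmas on the polynomial start to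
       apply. *)
    assert (HR : 4 <= Rmax (R0 - eps) 4) by apply Rmax_r.
    assert (HRlt : Rmax (R0 - eps) 4 < R0) by (apply Rmax_lub_lt; lra).
    destruct (not_competitive Alg (Rmax (R0 - eps) 4)) as [D0 [HD0 H]]; [exact HR| |].
    { rewrite <- Hroot. now apply mtlm_poly_increasing. }
    exists D0. split; [exact HD0|]. intros D HD.
    apply (Glb_Rbar_correct (competitive Alg D)).
    (* As Opt's cost is nonnegative, a ratio below R0 - eps would make the larger, excluded one
       achievable too. *)
    intros rho [gamma Hrho]. simpl. apply Rnot_lt_le. intros Hlt.
    apply (H D HD). exists gamma. intros ps Hps.
    specialize (Hrho ps Hps).
    pose proof (opt_cost_nonneg D ps ltac:(lra)).
    pose proof (Rmax_l (R0 - eps) 4). nra.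
Qed.
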